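(* The function $\mathcal{I}\colon[0,1]\cap\mathbb{Q}\to\mathbb{R}$ extends uniquely to a continuous, strictly increasing function $\mathcal{I}\colon[0,1]\to\mathbb{R}$. Moreover, for all real $x\in[0,1]$ the extension satisfies $\mathcal{I}(0)=0$, $\mathcal{I}(x)=4^{-\lfloor1/x\rfloor}\big(1-2\,\mathcal{I}(\{1/x\})\big)$ if $0<x\le\tfrac12$, and $\mathcal{I}(x)=\tfrac38-\tfrac34\,\mathcal{I}(1/x-1)-\tfrac12\,\mathcal{I}(1-x)$ if $\tfrac12<x\le1$.
   Context: For $x\in\mathbb{R}$ let $\{x\}=x-\lfloor x\rfloor$. The interrobang function $\mathcal{I}\colon[0,1]\cap\mathbb{Q}\to\mathbb{R}$ is defined recursively by $\mathcal{I}(0)=0$; $\mathcal{I}(x)=4^{-\lfloor1/x\rfloor}\big(1-2\,\mathcal{I}(\{1/x\})\big)$ if $0<x\le\tfrac12$; and $\mathcal{I}(x)=\tfrac38-\tfrac34\,\mathcal{I}(1/x-1)-\tfrac12\,\mathcal{I}(1-x)$ if $\tfrac12<x\le1$. The recursion is well founded: with the height $a/b\mapsto|a|+|b|$ ($\gcd(a,b)=1$), every argument on the right-hand side has strictly smaller height than $x$, so $\mathcal{I}$ is uniquely defined. *)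

(* Defs.v *)
From HB Require Import structures.
From mathcomp Require Import all_boot all_order all_algebra.
From mathcomp Require Import all_classical all_reals all_analysis.
Set Implicit Arguments. Unset Strict Implicit. Unset Printing Implicit Defensive.
Import Order.TTheory GRing.Theory Num.Theory.
Local Open Scope ring_scope.

Definition fracpart {R : archiDomainType} (x : R) : R := x - (Num.floor x)%:~R.

Definition qheight (x : rat) : nat := (`|numq x| + `|denq x|)%N.

(* Fuel-driven unfolding of the interrobang recursion on rationals.
   Every recursive argument has strictly smaller height, so fuel = height
   suffices (the value is independent of any fuel >= height). *)
Fixpoint Iq_fuel (n : nat) (x : rat) : rat :=
  match n with
  | O => 0
  | S n' =>
      if x == 0 then 0
      else if x <= 1 / 2 then
        (4 : rat) ^ (- Num.floor x^-1) * (1 - 2 * Iq_fuel n' (fracpart x^-1))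
      else 3 / 8 - 3 / 4 * Iq_fuel n' (x^-1 - 1) - 1 / 2 * Iq_fuel n' (1 - x)
  end.

(* The interrobang function on [0,1] ∩ Q (values outside [0,1] are irrelevant). *)
Definition interrobangQ (x : rat) : rat := Iq_fuel (qheight x) x.

(* Main.v *)
Require Import Defs.
From HB Require Import structures.
From mathcomp Require Import all_boot all_order all_algebra.
From mathcomp Require Import all_classical all_reals all_analysis.
From mathcomp Require Import ring lra zify.
Import Order.TTheory GRing.Theory Num.Theory.
Import numFieldNormedType.Exports.
Local Open Scope ring_scope.
Local Open Scope classical_set_scope.

(** The right-hand side of the recursion is a map T on functions on [0, 1].
    It contracts, by the factor 11/12, the supremum norm that gives weight 3 to
    [0, 1/2], and it preserves the nondecreasing functions with values 0, 1/16
    and 3/8 at 0, 1/2 and 1; the extension F is the pointwise limit of the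
    iterates of T on one of them, so it is nondecreasing and F = T F.

    Each closed piece [1/(n+1), 1/n] is parametrised by x = 1/(n + t), and the
    functional equation bounds the one-sided jumps of F at x by jumps at t and,
    for n = 1, at 1 - x. The weights that make T a contraction make the
    supremum of the jumps contract too, so F has no jump. The same equation
    carries strict monotonicity at t to x, which proves it at every fraction
    a/b by induction on a + b. Uniqueness needs only that F has no jump and
    that monotone functions agree with F on the rationals. *)

(** * The recursion as a map, and the pieces x = 1/(n + t) *)

Definition interrobang_step {R : realType} (f : R -> R) (x : R) : R :=
  if x <= 0 then 0
  else if x <= 1 / 2 then
    4 ^ (- Num.floor x^-1) * (1 - 2 * f (fracpart x^-1))
  else 3 / 8 - 3 / 4 * f (x^-1 - 1) - 1 / 2 * f (1 - x).

(** The recursion forces these three values. With them [interrobang_step f] is at least 3/8 - 3/4 *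
    3/8 - 1/2 * 1/16 = 1/16 on (1/2, 1], exactly its value at 1/2, so the two branches stay in
    order. *)
Record admissible {R : realType} (f : R -> R) : Prop := Admissible {
  admissible_le : forall x y, 0 <= x -> x <= y -> y <= 1 -> f x <= f y;
  admissible0 : f 0 = 0;
  admissible_half : f (1 / 2) = 1 / 16;
  admissible1 : f 1 = 3 / 8 }.

Lemma floor_natD {R : archiRealDomainType} (n : nat) (t : R) :
  0 <= t < 1 -> Num.floor (n%:R + t) = n%:Z.
Proof.
move=> /andP[t0 t1]; apply: floor_def.
by rewrite intrD mulr1z -pmulrn lerDl t0 ltrD2l.
Qed.

Lemma inv_natD_exists {R : realType} (x : R) : 0 < x <= 1 ->
  exists n t, [/\ (0 < n)%N, 0 <= t < 1 & x = (n%:R + t)^-1].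
Proof.
move=> /andP[x0 x1].
have x1' : 1 <= x^-1 by rewrite invf_ge1.
have := floor_itv x^-1; have : 1 <= Num.floor x^-1 by rewrite floor_ge_int.
case: (Num.floor x^-1) => // n n1.
rewrite intrD mulr1z -pmulrn => /andP[h1 h2].
exists n, (x^-1 - n%:R); split => //; last by rewrite addrC subrK invrK.
by apply/andP; split; lra.
Qed.

Lemma natD_gt0 {R : realFieldType} (n : nat) (t : R) :
  (0 < n)%N -> 0 <= t -> 0 < n%:R + t.
Proof. by move=> n0 t0; rewrite ltr_wpDr // ltr0n. Qed.

Lemma inv_natD_exists_small {R : realType} (x : R) : 0 < x <= 1 / 2 ->
  exists n t, [/\ (1 < n)%N, 0 <= t < 1 & x = (n%:R + t)^-1].
Proof.
move=> /andP[x0 xh].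
have [|n [t [n0 t01 E]]] := inv_natD_exists x; first by apply/andP; split; lra.
exists n, t; split => //; rewrite ltn_neqAle n0 andbT; apply/eqP => n1.
case/andP: t01 => t0 t1; move: xh; rewrite E -n1 leNgt => /negP; apply.
by rewrite div1r ltf_pV2 ?posrE; lra.
Qed.

Lemma step_large {R : realType} (f : R -> R) (x : R) : 1 / 2 < x ->
  interrobang_step f x = 3 / 8 - 3 / 4 * f (x^-1 - 1) - 1 / 2 * f (1 - x).
Proof.
move=> xh; rewrite /interrobang_step [x <= 0]leNgt [x <= _]leNgt xh.
by rewrite (lt_trans _ xh) //; lra.
Qed.

Lemma step_small {R : realType} (f : R -> R) (n : nat) (t : R) :
  (1 < n)%N -> 0 <= t < 1 ->
  interrobang_step f (n%:R + t)^-1 = 4 ^- n * (1 - 2 * f t).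
Proof.
move=> n1 t01; have /andP[t0 t1] := t01.
have h : 0 < n%:R + t by rewrite natD_gt0 // ltnW.
have n2 : 2 <= n%:R :> R by rewrite ler_nat.
rewrite /interrobang_step invr_le0 leNgt h /= div1r lef_pV2 ?posrE //.
rewrite ifT; last by lra.
by rewrite invrK /fracpart floor_natD // -pmulrn addrAC subrr add0r exprnN.
Qed.

Lemma step0 {R : realType} (f : R -> R) : interrobang_step f 0 = 0.
Proof. by rewrite /interrobang_step lexx. Qed.

(** * Preservation of admissible functions, and contraction *)

Lemma admissible_bounds {R : realType} (f : R -> R) (x : R) :
  admissible f -> 0 <= x <= 1 -> 0 <= f x <= 3 / 8.
Proof.
move=> [m e0 _ e1] /andP[x0 x1].
by rewrite -e1 -{1}e0 !m.
Qed.

Lemma inv_sub1_itv {R : realType} (x : R) : 1 / 2 < x <= 1 -> 0 <= x^-1 - 1 < 1.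
Proof.
move=> /andP[xh x1]; have xp : 0 < x by lra.
have e : x * x^-1 = 1 by rewrite divff // gt_eqF.
by apply/andP; split; nra.
Qed.

Lemma expV4_gt0 {R : realType} (n : nat) : 0 < 4 ^- n :> R.
Proof. by rewrite invr_gt0 exprn_gt0. Qed.

Lemma expV4_leD {R : realType} (m n : nat) : (m < n)%N ->
  4 ^- n <= 4 ^- m / 4 :> R.
Proof.
by move=> mn; rewrite -invfM -exprSr lef_pV2 ?posrE ?exprn_gt0 // ler_eXn2l //; lra.
Qed.

Lemma expV4_le16 {R : realType} (n : nat) : (1 < n)%N -> 4 ^- n <= 1 / 16 :> R.
Proof. by move=> n1; have := @expV4_leD R 1 n n1; rewrite expr1; lra. Qed.

(** Since 0 <= f <= 3/8, the factor 1 - 2 f(t) lies in [1/4, 1]: values on piece n lie between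
    4^-(n+1) and 4^-n, which orders the pieces. Within a piece the parametrisation and the formula
    both reverse order. *)
Lemma admissible_step {R : realType} (f : R -> R) :
  admissible f -> admissible (interrobang_step f).
Proof.
move=> af; have bf := admissible_bounds f _ af.
have [m e0 eh e1] := af.
have smallb n t : (1 < n)%N -> 0 <= t < 1 ->
    4 ^- n / 4 <= interrobang_step f (n%:R + t)^-1 <= 4 ^- n.
  move=> n1 t01; rewrite step_small //.
  have /andP[b0 b1] : 0 <= f t <= 3 / 8.
    by apply: bf; case/andP: t01 => t0 t1; apply/andP; split; lra.
  by have := @expV4_gt0 R n; move=> h; apply/andP; split; nra.
have largeb y : 1 / 2 < y -> y <= 1 -> 1 / 16 <= interrobang_step f y.
  move=> yh y1; rewrite step_large //.
  have /andP[i0 i1] : 0 <= y^-1 - 1 < 1 by apply: inv_sub1_itv; rewrite yh y1.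
  have : f (1 - y) <= f (1 / 2) by apply: m; lra.
  have /andP[_] : 0 <= f (y^-1 - 1) <= 3 / 8 by apply: bf; rewrite i0 ltW.
  by rewrite eh; lra.
have half : interrobang_step f (1 / 2) = 1 / 16.
  by have := step_small f 2 0 isT; rewrite addr0 div1r => ->; rewrite ?e0 ?lexx ?ltr01; lra.
split => //; last 2 first.
- by rewrite step0.
- by rewrite step_large ?invr1 ?subrr ?e0; lra.
move=> x y x0 xy y1.
have [->|xn0] := eqVneq x 0.
  rewrite step0; have [yh|yh] := leP y (1/2).
    have [->|yn0] := eqVneq y 0; first by rewrite step0.
    have [|n [t [n1 t01 ->]]] := inv_natD_exists_small y.
      by rewrite lt0r yn0 yh (le_trans x0 xy).
    by have := @expV4_gt0 R n; have /andP[] := smallb n t n1 t01; lra.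
  by have := largeb y yh y1; lra.
have xp : 0 < x by rewrite lt0r xn0 x0.
have [yh|yh] := leP y (1/2).
  have [|n [t [n1 t01 Ey]]] := inv_natD_exists_small y.
    by rewrite yh (lt_le_trans xp xy).
  have [|n' [t' [n1' t01' Ex]]] := inv_natD_exists_small x.
    by rewrite xp (le_trans xy yh).
  have /andP[t0 t1] := t01; have /andP[t0' t1'] := t01'.
  have xy' : n%:R + t <= n'%:R + t'.
    by rewrite -lef_pV2 ?posrE ?natD_gt0 -?Ex -?Ey // ltnW.
  have [nn|nn|nn] := ltngtP n n'.
  - rewrite Ex Ey; have := @expV4_leD R n n' nn.
    by have /andP[] := smallb n t n1 t01; have /andP[] := smallb n' t' n1' t01'; lra.
  (* Impossible case: n' + t' < n' + 1 <= n <= n + t contradicts [xy']. *)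
  - have : n'.+1%:R <= n%:R :> R by rewrite ler_nat.
    by rewrite mulrSr; lra.
  - rewrite Ex Ey -nn !step_small //; move: xy'; rewrite -nn lerD2l => tt.
    have : f t <= f t' by apply: m => //; lra.
    by have := @expV4_gt0 R n; nra.
have [xh|xh] := leP x (1/2).
  have [|n [t [n1 t01 ->]]] := inv_natD_exists_small x; first by rewrite xp xh.
  have /andP[_ h] := smallb n t n1 t01; apply: le_trans h _.
  exact: le_trans (expV4_le16 _ n1) (largeb _ yh y1).
have /andP[i0 i1] : 0 <= y^-1 - 1 < 1 by apply: inv_sub1_itv; rewrite yh y1.
have /andP[j0 j1] : 0 <= x^-1 - 1 < 1 by apply: inv_sub1_itv; rewrite xh (le_trans xy).
rewrite !step_large //.
have : f (y^-1 - 1) <= f (x^-1 - 1).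
  apply: m => //; last exact: ltW.
  by rewrite lerD2r lef_pV2 // posrE; lra.
have : f (1 - y) <= f (1 - x) by apply: m; lra.
by lra.
Qed.

(* The supremum norm with weight 3 on [0, 1/2]: the step map is a contraction
   for it, but not for the unweighted norm, since 3/4 + 1/2 > 1. *)
Definition weighted_close {R : realType} (e : R) (f g : R -> R) : Prop :=
  (forall x, 0 <= x <= 1 -> `|f x - g x| <= e) /\
  (forall x, 0 <= x <= 1 / 2 -> `|f x - g x| <= e / 3).

(** On [0, 1/2] differences shrink by 2 * 4^-n <= 1/8, and 1/8 <= (11/12)/3. Above 1/2 the point 1 -
    x lies in the lower half, so the bound is 3/4 e + 1/2 (e/3) = 11/12 e. *)
Lemma step_contraction {R : realType} (e : R) (f g : R -> R) :
  0 <= e -> weighted_close e f g ->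
  weighted_close (11 / 12 * e) (interrobang_step f) (interrobang_step g).
Proof.
move=> e0 [c1 c2].
have small x : 0 <= x <= 1 / 2 ->
    `|interrobang_step f x - interrobang_step g x| <= e / 8.
  move=> /andP[x0 xh]; have [->|xn0] := eqVneq x 0.
    by rewrite !step0 subrr normr0; lra.
  have [|n [t [n1 t01 ->]]] := inv_natD_exists_small x.
    by rewrite lt0r xn0 x0.
  rewrite !step_small //.
  have : `|f t - g t| <= e.
    by case/andP: t01 => t0 t1; apply: c1; rewrite t0 ltW.
  have := @expV4_gt0 R n; have := @expV4_le16 R n n1.
  by rewrite !ler_norml => h1 h2 /andP[h3 h4]; apply/andP; split; nra.
have large x : 1 / 2 < x <= 1 ->
    `|interrobang_step f x - interrobang_step g x| <= 11 / 12 * e.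
  move=> xx; have /andP[xh x1] := xx; rewrite !step_large //.
  have /andP[t0 t1] := inv_sub1_itv x xx.
  have : `|f (x^-1 - 1) - g (x^-1 - 1)| <= e by apply: c1; rewrite t0 ltW.
  have : `|f (1 - x) - g (1 - x)| <= e / 3 by apply: c2; apply/andP; split; lra.
  by rewrite !ler_norml => /andP[h1 h2] /andP[h3 h4]; apply/andP; split; lra.
split=> x /andP[x0 x1]; last first.
  by apply: le_trans (small x _) _; [rewrite x0 | lra].
have [xh|xh] := leP x (1 / 2); last by apply: large; rewrite xh.
by apply: le_trans (small x _) _; [rewrite x0 | lra].
Qed.

(* The interpolation of the values 0, 1/16 and 3/8 at 0, 1/2 and 1. *)
Definition interrobang_seed {R : realType} (x : R) : R := x ^+ 2 / 8 + x ^+ 3 / 4.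

Lemma admissible_seed {R : realType} : admissible (@interrobang_seed R).
Proof.
rewrite /interrobang_seed; split; [|by lra|by lra|by lra].
move=> x y x0 xy y1; rewrite lerD // ler_pM2r ?invr_gt0 //.
  by rewrite lerXn2r // nnegrE //; lra.
by rewrite lerXn2r // nnegrE //; lra.
Qed.

(** * The limit of the iterates and its functional equation *)

Definition interrobang_iter {R : realType} (n : nat) : R -> R :=
  iter n interrobang_step interrobang_seed.

Lemma admissible_iter {R : realType} (n : nat) :
  admissible (@interrobang_iter R n).
Proof.
by elim: n => [|n IH]; [exact: admissible_seed | exact: admissible_step].
Qed.

Lemma iter_close {R : realType} (n : nat) :
  weighted_close ((11 / 12) ^+ n * 2)
    (@interrobang_iter R n.+1) (interrobang_iter n).
Proof.
elim: n => [|n IH]; last first.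
  by rewrite exprS -mulrA; exact: step_contraction.
(* The constant 2 is ample: admissible functions differ by at most 3/8, which is below 2/3. *)
rewrite expr0 mul1r; split=> x /andP[x0 x1].
all: have /andP[] := @admissible_bounds R _ x (admissible_iter 0) ltac:(apply/andP; split; lra).
all: have /andP[] := @admissible_bounds R _ x (admissible_iter 1) ltac:(apply/andP; split; lra).
all: by move=> *; rewrite ler_norml; apply/andP; split; lra.
Qed.

(** The telescoping series of [u] is dominated by a geometric series, hence converges absolutely. *)
Lemma is_cvg_geometric_bound {R : realType} (u : R^nat) (a z : R) : 0 <= z < 1 ->
  (forall n, `|u n.+1 - u n| <= a * z ^+ n) -> cvgn u.
Proof.
move=> /andP[z0 z1] h.
have ctel : cvgn (series (telescope u)).
  apply: normed_cvg.
  apply: (@series_le_cvg _ _ (geometric a z)) => //.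
  - by move=> n; rewrite normr_ge0.
  - by move=> n; exact: le_trans (h n).
  - by apply: is_cvg_geometric_series; rewrite ger0_norm.
have -> : u = (fun n => u 0%N + series (telescope u) n).
  by apply/funext => n; rewrite -eq_sum_telescope.
by apply: is_cvgD => //; exact: is_cvg_cst.
Qed.

Lemma cvg_iter {R : realType} (x : R) : 0 <= x <= 1 ->
  cvgn (fun n => interrobang_iter n x).
Proof.
move=> x01; apply: (@is_cvg_geometric_bound R _ 2 (11 / 12)).
  by apply/andP; split; lra.
by move=> n; rewrite mulrC; have [h _] := @iter_close R n; exact: h.
Qed.

Definition interrobang {R : realType} (x : R) : R :=
  limn (fun n => interrobang_iter n x).

Lemma interrobang_cvg {R : realType} (x : R) : 0 <= x <= 1 ->
  (fun n => interrobang_iter n x) @ \oo --> interrobang x.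
Proof. exact: cvg_iter. Qed.

Lemma admissible_interrobang {R : realType} : admissible (@interrobang R).
Proof.
split.
- move=> x y x0 xy y1; apply: ler_lim.
  + by apply: cvg_iter; rewrite x0 (le_trans xy).
  + by apply: cvg_iter; rewrite y1 (le_trans x0).
  + by apply: nearW => n; apply: (admissible_le _ (admissible_iter n)).
- rewrite /interrobang; under eq_fun do rewrite (admissible0 _ (admissible_iter _)).
  by rewrite lim_cst.
- rewrite /interrobang; under eq_fun do rewrite (admissible_half _ (admissible_iter _)).
  by rewrite lim_cst.
- rewrite /interrobang; under eq_fun do rewrite (admissible1 _ (admissible_iter _)).
  by rewrite lim_cst.
Qed.

(** At each x the step map uses at most two values of its argument, so pointwise convergence lets
    the limit pass through it; the shifted sequence of iterates has the same limit. *)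
Lemma interrobang_fixpoint {R : realType} (x : R) : 0 <= x <= 1 ->
  interrobang_step interrobang x = interrobang x.
Proof.
move=> x01; have /andP[x0 x1] := x01.
have cS : (fun n => interrobang_iter n.+1 x) @ \oo --> interrobang x.
  by rewrite (cvg_shiftS (fun n => interrobang_iter n x)); exact: interrobang_cvg.
suff : (fun n => interrobang_iter n.+1 x) @ \oo --> interrobang_step interrobang x.
  by move=> /cvg_unique; apply.
have [->|xn0] := eqVneq x 0.
  by rewrite step0; under eq_fun do rewrite /= step0; exact: cvg_cst.
have [xh|xh] := leP x (1 / 2).
  have [|n [t [n1 t01 ->]]] := inv_natD_exists_small x.
    by rewrite lt0r xn0 x0.
  rewrite step_small //; under eq_fun do rewrite /= step_small //.
  have ct : (fun n => interrobang_iter n t) @ \oo --> interrobang t.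
    by apply: interrobang_cvg; case/andP: t01 => t0 t1; rewrite t0 ltW.
  apply: cvgM; first exact: cvg_cst.
  apply: cvgB; first exact: cvg_cst.
  by apply: cvgM => //; exact: cvg_cst.
rewrite step_large //; under eq_fun do rewrite /= step_large //.
have /andP[t0 t1] : 0 <= x^-1 - 1 < 1 by apply: inv_sub1_itv; rewrite xh.
have ct : (fun n => interrobang_iter n (x^-1 - 1)) @ \oo --> interrobang (x^-1 - 1).
  by apply: interrobang_cvg; rewrite t0 ltW.
have ct' : (fun n => interrobang_iter n (1 - x)) @ \oo --> interrobang (1 - x).
  by apply: interrobang_cvg; apply/andP; split; lra.
apply: cvgB; last by apply: cvgM => //; exact: cvg_cst.
by apply: cvgB; [exact: cvg_cst|apply: cvgM => //; exact: cvg_cst].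
Qed.

(** * Absence of jumps *)

Lemma interrobang_le {R : realType} (x y : R) :
  0 <= x -> x <= y -> y <= 1 -> interrobang x <= interrobang y.
Proof. exact: admissible_le admissible_interrobang x y. Qed.

Lemma interrobang0 {R : realType} : interrobang (0 : R) = 0.
Proof. exact: admissible0 admissible_interrobang. Qed.

Lemma interrobang_half {R : realType} : interrobang (1 / 2 : R) = 1 / 16.
Proof. exact: admissible_half admissible_interrobang. Qed.

Lemma interrobang1 {R : realType} : interrobang (1 : R) = 3 / 8.
Proof. exact: admissible1 admissible_interrobang. Qed.

(** * The functional equation on closed pieces *)

Lemma inv_natD_itv {R : realType} (n : nat) (t : R) :
  (0 < n)%N -> 0 <= t -> 0 <= (n%:R + t)^-1 <= 1.
Proof.
move=> n0 t0; have p := @natD_gt0 R n t n0 t0.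
rewrite invr_ge0 ltW //= invf_le1 //.
by have : 1%:R <= n%:R :> R by [rewrite ler_nat]; lra.
Qed.

(* On the closed pieces, endpoints included: the two formulas agree there. *)
Lemma interrobang_small {R : realType} (n : nat) (t : R) :
  (1 < n)%N -> 0 <= t <= 1 ->
  interrobang (n%:R + t)^-1 = 4 ^- n * (1 - 2 * interrobang t).
Proof.
move=> n1 /andP[t0]; rewrite le_eqVlt => /orP[/eqP->|t1]; last first.
  by rewrite -interrobang_fixpoint ?step_small ?t0 // inv_natD_itv // ltnW.
rewrite -interrobang_fixpoint ?inv_natD_itv // ?(ltnW n1) //.
have -> : n%:R + 1 = n.+1%:R + 0 :> R by rewrite addr0 natr1.
rewrite step_small ?lexx ?ltr01 // ?(leqW n1) //.
by rewrite interrobang0 interrobang1 exprSr invfM; lra.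
Qed.

(** The endpoint 1/2 is allowed because 1/16 = 3/8 - 3/4 * 3/8 - 1/2 * 1/16. *)
Lemma interrobang_large {R : realType} (x : R) : 1 / 2 <= x <= 1 ->
  interrobang x =
  3 / 8 - 3 / 4 * interrobang (x^-1 - 1) - 1 / 2 * interrobang (1 - x).
Proof.
move=> /andP[]; rewrite le_eqVlt => /orP[/eqP<- _|xh x1].
  have -> : (1 / 2)^-1 - 1 = 1 :> R by field.
  have -> : 1 - 1 / 2 = 1 / 2 :> R by field.
  by rewrite interrobang1 interrobang_half; lra.
by rewrite -step_large // interrobang_fixpoint //; apply/andP; split; lra.
Qed.

(** Approaching x from the right means approaching t from the left, which requires t > 0; an
    endpoint 1/(n + 0) is therefore read as 1/((n - 1) + 1). *)
Lemma inv_natD_exists_ltr {R : realType} (x : R) : 0 < x < 1 ->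
  exists n t, [/\ (0 < n)%N, 0 < t <= 1 & x = (n%:R + t)^-1].
Proof.
move=> /andP[x0 x1].
have [|n [t [n0 /andP[t0 t1] E]]] := inv_natD_exists x; first by rewrite x0 ltW.
move: t0; rewrite le_eqVlt => /orP[/eqP t0|t0]; last first.
  by exists n, t; rewrite t0 ltW.
case: n n0 E => // -[|n] _ E; last first.
  by exists n.+1, 1; rewrite ltr01 lexx E -t0 addr0 natr1.
by move: x1; rewrite E -t0 addr0 invr1 ltxx.
Qed.

Lemma ltf_inv_natD {R : realType} (n : nat) (s t : R) : (0 < n)%N ->
  0 <= s -> s < t -> (n%:R + t)^-1 < (n%:R + s)^-1.
Proof.
move=> n0 s0 st.
by rewrite ltf_pV2 ?ltrD2l // posrE natD_gt0 //; lra.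
Qed.

(** * One-sided jumps and their contraction *)

(** Says that the right jump at x is at most e: by monotonicity a single witness y controls all of
    (x, y]. *)
Definition right_gap {R : realType} (x e : R) : Prop :=
  exists y, [/\ x < y, y <= 1 & interrobang y - interrobang x <= e].

Definition left_gap {R : realType} (x e : R) : Prop :=
  exists y, [/\ 0 <= y, y < x & interrobang x - interrobang y <= e].

(** The map t |-> 1/(n + t) reverses order, so sides are exchanged; the formula scales differences
    by 2 * 4^-n <= 1/8. *)
Lemma right_gap_small {R : realType} (n : nat) (t e : R) : (1 < n)%N ->
  0 < t <= 1 -> left_gap t e -> right_gap (n%:R + t)^-1 (e / 8).
Proof.
move=> n1 /andP[t0 t1] [z [z0 zt h]].
exists (n%:R + z)^-1; split.
- by rewrite ltf_inv_natD // ltnW.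
- by have /andP[] := @inv_natD_itv R n z (ltnW n1) z0.
- rewrite !interrobang_small //; try by apply/andP; split; lra.
  have := @interrobang_le R z t z0 (ltW zt) t1.
  by have := @expV4_gt0 R n; have := @expV4_le16 R n n1; nra.
Qed.

Lemma left_gap_small {R : realType} (n : nat) (t e : R) : (1 < n)%N ->
  0 <= t < 1 -> right_gap t e -> left_gap (n%:R + t)^-1 (e / 8).
Proof.
move=> n1 /andP[t0 t1] [z [zt z1 h]].
have z0 : 0 <= z by lra.
exists (n%:R + z)^-1; split.
- by have /andP[] := @inv_natD_itv R n z (ltnW n1) z0.
- by rewrite ltf_inv_natD // ltnW.
- rewrite !interrobang_small //; try by apply/andP; split; lra.
  have := @interrobang_le R t z t0 (ltW zt) z1.
  by have := @expV4_gt0 R n; have := @expV4_le16 R n n1; nra.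
Qed.

Lemma right_gap_large {R : realType} (x e e' : R) : 1 / 2 <= x < 1 ->
  left_gap (x^-1 - 1) e -> left_gap (1 - x) e' ->
  right_gap x (3 / 4 * e + 1 / 2 * e').
Proof.
move=> /andP[xh x1] [z [z0 zx h]] [z' [z0' zx' h']].
have x0 : 0 < x by lra.
have p : 0 < 1 + z by lra.
have xz : x < (1 + z)^-1 by rewrite -[x]invrK ltf_pV2 ?posrE ?invr_gt0 //; lra.
have z1 : (1 + z)^-1 <= 1 by rewrite invf_le1; lra.
(* The two candidates are sent to z by y |-> 1/y - 1 and to z' by y |-> 1 - y. Both maps decrease,
   so the smaller candidate satisfies both bounds by monotonicity. *)
pose y := Num.min (1 + z)^-1 (1 - z').
have xy : x < y by rewrite lt_min xz; lra.
have yz' : y <= 1 - z' by rewrite ge_min lexx orbT.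
have yz : y <= (1 + z)^-1 by rewrite ge_min lexx.
have y1 : y <= 1 by apply: le_trans yz z1.
have zy : z <= y^-1 - 1.
  by rewrite lerBrDl -[1 + z]invrK lef_pV2 ?posrE ?invr_gt0; lra.
have yx : y^-1 < x^-1 by rewrite ltf_pV2 ?posrE; lra.
have xi : x^-1 <= 2 by rewrite -[2]invrK lef_pV2 ?posrE; lra.
exists y; split => //.
rewrite [interrobang y]interrobang_large ?[interrobang x]interrobang_large;
  try by apply/andP; split; lra.
have : interrobang z <= interrobang (y^-1 - 1) by apply: interrobang_le; lra.
have : interrobang z' <= interrobang (1 - y) by apply: interrobang_le; lra.
by lra.
Qed.

Lemma left_gap_large {R : realType} (x e e' : R) : 1 / 2 < x <= 1 ->
  right_gap (x^-1 - 1) e -> right_gap (1 - x) e' ->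
  left_gap x (3 / 4 * e + 1 / 2 * e').
Proof.
move=> xx [z [zx z1 h]] [z' [zx' z1' h']].
have /andP[xh x1] := xx.
have x0 : 0 < x by lra.
have /andP[t0 t1] := inv_sub1_itv x xx.
have p : 0 < 1 + z by lra.
have xz : (1 + z)^-1 < x by rewrite -[x]invrK ltf_pV2 ?posrE ?invr_gt0 //; lra.
have zh : 1 / 2 <= (1 + z)^-1 by rewrite div1r lef_pV2 ?posrE //; lra.
pose y := Num.max (1 + z)^-1 (1 - z').
have xy : y < x by rewrite gt_max xz; lra.
have yz' : 1 - z' <= y by rewrite le_max lexx orbT.
have yz : (1 + z)^-1 <= y by rewrite le_max lexx.
have yh : 1 / 2 <= y by apply: le_trans zh yz.
have zy : y^-1 - 1 <= z.
  by rewrite lerBlDl -[1 + z]invrK lef_pV2 ?posrE ?invr_gt0; lra.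
have yx : x^-1 < y^-1 by rewrite ltf_pV2 ?posrE; lra.
exists y; split => //; first by lra.
rewrite [interrobang y]interrobang_large ?[interrobang x]interrobang_large;
  try by apply/andP; split; lra.
have : interrobang (y^-1 - 1) <= interrobang z by apply: interrobang_le; lra.
have : interrobang (1 - y) <= interrobang z' by apply: interrobang_le; lra.
by lra.
Qed.

Lemma gap_le {R : realType} (x e e' : R) : e <= e' ->
  (right_gap x e -> right_gap x e') /\ (left_gap x e -> left_gap x e').
Proof. by move=> ee; split=> -[y [? ? h]]; exists y; split => //; lra. Qed.

(** The exponent is at least 2 so that [right_gap0] can use it as the index of a piece inside
    [0, 1/2]. *)
Lemma exists_expr_le {R : realType} (z e : R) : 0 <= z < 1 -> 0 < e ->
  exists n, z ^+ n.+2 <= e.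
Proof.
move=> /andP[z0 z1] e0.
have /cvg_expr/cvgrPdist_le/(_ e e0)[N _ hN] : `|z| < 1 by rewrite ger0_norm.
exists N; have := hN N.+2 (leqW (leqW (leqnn N))) => /=.
by rewrite sub0r normrN ger0_norm // exprn_ge0.
Qed.

Lemma right_gap0 {R : realType} (e : R) : 0 < e -> right_gap 0 e.
Proof.
move=> e0; have [|n hn] := @exists_expr_le R 4^-1 e _ e0.
  by apply/andP; split; lra.
exists n.+2%:R^-1; split; first by rewrite invr_gt0 ltr0n.
- by rewrite invf_le1 ?ltr0n // ler1n.
- rewrite -[n.+2%:R]addr0 interrobang_small ?lexx ?ler01 // interrobang0.
  by rewrite -exprVn; lra.
Qed.

(** The analogue of [weighted_close] for jumps. The point 1/2 belongs to the lower half for left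
    jumps and to the upper half for right jumps, according to the side approached. *)
Definition gaps {R : realType} (e : R) : Prop :=
  [/\ forall x, 0 <= x < 1 -> right_gap x e,
      forall x, 0 <= x < 1 / 2 -> right_gap x (e / 3),
      forall x, 0 < x <= 1 -> left_gap x e &
      forall x, 0 < x <= 1 / 2 -> left_gap x (e / 3)].

(** Same arithmetic as in [step_contraction]: e/8 in the lower half, 3/4 e + 1/2 (e/3) = 11/12 e in
    the upper half. *)
Lemma gaps_contraction {R : realType} (e : R) :
  0 < e -> gaps e -> gaps (11 / 12 * e).
Proof.
move=> e0 [r1 r2 l1 l2].
have rs x : 0 <= x < 1 / 2 -> right_gap x (e / 8).
  move=> /andP[x0 xh].
  have [->|xn0] := eqVneq x 0; first by apply: right_gap0; lra.
  have [|n [t [n0 t01 E]]] := inv_natD_exists_ltr x.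
    by rewrite lt0r xn0 x0; lra.
  have /andP[t0 t1] := t01.
  rewrite E; apply: right_gap_small; [|by []|exact: l1].
  (* Piece 1 is excluded: t <= 1 would give x >= 1/2. *)
  rewrite ltn_neqAle n0 andbT; apply/eqP => n1.
  move: xh; rewrite E -n1 ltNge => /negP; apply.
  by rewrite div1r lef_pV2 ?posrE; lra.
have ls x : 0 < x <= 1 / 2 -> left_gap x (e / 8).
  move=> /inv_natD_exists_small[n [t [n1 t01 ->]]].
  by apply: left_gap_small => //; exact: r1.
have rl x : 1 / 2 <= x < 1 -> right_gap x (11 / 12 * e).
  move=> /andP[xh x1].
  have [|h _] := @gap_le R x (3 / 4 * e + 1 / 2 * (e / 3)) (11 / 12 * e).
  - by lra.
  - apply: h; apply: right_gap_large; first by rewrite xh.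
    + have x0 : 0 < x by lra.
      have : x^-1 <= 2 by rewrite -[2]invrK lef_pV2 ?posrE; lra.
      by move=> xi; apply: l1; rewrite subr_gt0 invf_gt1 // x1; lra.
    + by apply: l2; apply/andP; split; lra.
have ll x : 1 / 2 < x <= 1 -> left_gap x (11 / 12 * e).
  move=> xx; have /andP[xh x1] := xx.
  have [|_ h] := @gap_le R x (3 / 4 * e + 1 / 2 * (e / 3)) (11 / 12 * e).
    by lra.
  apply: h; apply: left_gap_large => //; first exact/r1/inv_sub1_itv.
  by apply: r2; apply/andP; split; lra.
have le1 : e / 8 <= 11 / 12 * e by lra.
have le2 : e / 8 <= 11 / 12 * e / 3 by lra.
split => x.
- move=> /andP[x0 x1]; have [xh|xh] := leP (1 / 2) x; first by apply: rl; rewrite xh.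
  by have [h _] := @gap_le R x _ _ le1; apply/h/rs; rewrite x0.
- by move=> x01; have [h _] := @gap_le R x _ _ le2; exact/h/rs.
- move=> /andP[x0 x1]; have [xh|xh] := leP x (1 / 2); last by apply: ll; rewrite xh.
  by have [_ h] := @gap_le R x _ _ le1; apply/h/ls; rewrite x0.
- by move=> x01; have [_ h] := @gap_le R x _ _ le2; exact/h/ls.
Qed.

Lemma gaps_exp {R : realType} (n : nat) : gaps ((11 / 12 : R) ^+ n).
Proof.
elim: n => [|n IH]; last first.
  by rewrite exprS; apply: gaps_contraction => //; rewrite exprn_gt0 //; lra.
have b (x : R) : 0 <= x -> x <= 1 -> 0 <= interrobang x <= 3 / 8.
  by move=> x0 x1; apply: admissible_bounds; [exact: admissible_interrobang|rewrite x0].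
have bh (x : R) : 0 <= x -> x <= 1 / 2 -> 0 <= interrobang x <= 1 / 16.
  move=> x0 x1; rewrite -interrobang_half interrobang_le //; last by lra.
  by have /andP[-> _] := b x x0 ltac:(lra).
rewrite expr0; split=> x /andP[x0 x1].
- by exists 1; split => //; rewrite interrobang1; have /andP[] := b x x0 (ltW x1); lra.
- exists (1 / 2); split => //; first by lra.
  by rewrite interrobang_half; have /andP[] := bh x x0 (ltW x1); lra.
- by exists 0; split => //; rewrite interrobang0; have /andP[] := b x (ltW x0) x1; lra.
- by exists 0; split => //; rewrite interrobang0; have /andP[] := bh x (ltW x0) x1; lra.
Qed.

Lemma interrobang_gaps {R : realType} (x e : R) : 0 < e -> 0 <= x <= 1 ->
  (x < 1 -> right_gap x e) /\ (0 < x -> left_gap x e).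
Proof.
move=> e0 /andP[x0 x1].
have [|n hn] := @exists_expr_le R (11 / 12) e _ e0; first by apply/andP; split; lra.
have [r _ l _] := @gaps_exp R n.+2; have [hr hl] := @gap_le R x _ _ hn.
by split=> xx; [apply/hr/r; rewrite x0 | apply/hl/l; rewrite xx].
Qed.

(** * Continuity *)

Lemma interrobang_continuous {R : realType} :
  {within `[0, 1], continuous (@interrobang R)}.
Proof.
apply/subspace_continuousP => x; rewrite /= in_itv /= => x01.
apply/cvgrPdist_le => e e0; rewrite /prop_near1 /nbhs /= /within /=.
have [rg lg] := interrobang_gaps x e e0 x01; have /andP[x0 x1] := x01.
(* A gap witness gives the radius on each side; at an endpoint of [0, 1] monotonicity alone gives
   the bound, with any radius. *)
have [d1 d10 h1] : exists2 d, 0 < d & forall y, 0 <= y <= 1 -> y < x + d ->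
    interrobang y <= interrobang x + e.
  have [xlt|xge] := ltP x 1.
    have [z [xz z1 hz]] := rg xlt; exists (z - x); first by lra.
    move=> y /andP[y0 y1] yz.
    by have : interrobang y <= interrobang z by [apply: interrobang_le; lra]; lra.
  exists 1 => // y /andP[y0 y1] yz.
  by have : interrobang y <= interrobang x by [apply: interrobang_le; lra]; lra.
have [d2 d20 h2] : exists2 d, 0 < d & forall y, 0 <= y <= 1 -> x - d < y ->
    interrobang x - e <= interrobang y.
  have [xlt|xge] := ltP 0 x.
    have [z [z0 zx hz]] := lg xlt; exists (x - z); first by lra.
    move=> y /andP[y0 y1] yz.
    by have : interrobang z <= interrobang y by [apply: interrobang_le; lra]; lra.
  exists 1 => // y /andP[y0 y1] yz.
  by have : interrobang x <= interrobang y by [apply: interrobang_le; lra]; lra.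
apply/nbhs_ballP; exists (Num.min d1 d2) => /=; first by rewrite lt_min d10.
move=> y; rewrite /ball /= lt_min !ltr_norml => /andP[/andP[a _] /andP[_ b]].
rewrite in_itv /= => y01.
have ay := h1 y y01 ltac:(lra); have by_ := h2 y y01 ltac:(lra).
suff : `|interrobang x - interrobang y| <= e by [].
by rewrite ler_norml; apply/andP; split; lra.
Qed.

(** * Values at fractions and strict monotonicity *)

(** One step of the Euclidean algorithm: a/b lies on piece b %/ a with parameter (b %% a)/a. *)
Lemma frac_inv_edivn {K : realFieldType} (a b : nat) : (0 < a)%N ->
  a%:R / b%:R = ((b %/ a)%:R + (b %% a)%:R / a%:R)^-1 :> K.
Proof.
move=> a0; have an0 : a%:R != 0 :> K by rewrite pnatr_eq0 -lt0n.
by rewrite -[a%:R / _]invrK invf_div [in LHS](divn_eq b a) natrD natrM mulrDl mulfK.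
Qed.

Lemma frac_le_half {K : realFieldType} (a b : nat) : (0 < b)%N ->
  (a%:R / b%:R <= 1 / 2 :> K) = (2 * a <= b)%N.
Proof.
move=> b0; rewrite ler_pdivrMr ?ltr0n // mulrAC ler_pdivlMr //.
by rewrite mul1r mulrC -natrM ler_nat.
Qed.

Lemma frac_itv {K : realFieldType} (a b : nat) : (a <= b)%N -> (0 < b)%N ->
  0 <= (a%:R / b%:R : K) <= 1.
Proof.
by move=> ab b0; rewrite divr_ge0 //= ler_pdivrMr ?ltr0n // mul1r ler_nat.
Qed.

Lemma modn_frac_itv {K : realFieldType} (a b : nat) : (0 < a)%N ->
  0 <= ((b %% a)%:R / a%:R : K) < 1.
Proof.
by move=> a0; rewrite divr_ge0 //= ltr_pdivrMr ?ltr0n // mul1r ltr_nat ltn_mod.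
Qed.

Lemma frac_sub1 {K : realFieldType} (a b : nat) : (a <= b)%N -> (0 < b)%N ->
  1 - a%:R / b%:R = (b - a)%:R / b%:R :> K.
Proof.
by move=> ab b0; rewrite natrB // mulrBl divff // pnatr_eq0 -lt0n.
Qed.

Lemma frac_inv_sub1 {K : realFieldType} (a b : nat) : (a <= b)%N -> (0 < a)%N ->
  (a%:R / b%:R)^-1 - 1 = (b - a)%:R / a%:R :> K.
Proof.
by move=> ab a0; rewrite invf_div natrB // mulrBl divff // pnatr_eq0 -lt0n.
Qed.

Lemma ratr_frac {R : realType} (a b : nat) :
  ratr (a%:R / b%:R) = a%:R / b%:R :> R.
Proof. by rewrite fmorph_div !rmorph_nat. Qed.

(* Fractions need not be in lowest terms: the bound a + b on the height
   decreases along the recursion all the same. *)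
Lemma interrobang_Iq_fuel {R : realType} (m a b : nat) :
  (a <= b)%N -> (0 < b)%N -> (a + b <= m)%N ->
  interrobang (a%:R / b%:R : R) = ratr (Iq_fuel m (a%:R / b%:R)).
Proof.
elim: m a b => [|m IH] a b ab b0 abm; first by lia.
rewrite /=; have [->|an0] := eqVneq a 0%N.
  by rewrite !mul0r eqxx interrobang0 rmorph0.
have a0 : (0 < a)%N by rewrite lt0n.
rewrite mulf_eq0 invr_eq0 !pnatr_eq0 (negbTE an0) -[b == 0%N]negbK -lt0n b0 /=.
rewrite frac_le_half //; case: ifP => [abh|/negbT]; last rewrite -ltnNge => abh.
  have n1 : (1 < b %/ a)%N by rewrite leq_divRL.
  have := ltn_pmod b a0 => ba.
  have fl : Num.floor (a%:R / b%:R : rat)^-1 = (b %/ a)%:Z.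
    by rewrite frac_inv_edivn // invrK floor_natD // modn_frac_itv.
  rewrite /fracpart fl.
  have -> : (a%:R / b%:R : rat)^-1 - (b %/ a)%:Z%:~R = (b %% a)%:R / a%:R.
    by rewrite frac_inv_edivn // invrK -pmulrn addrAC subrr add0r.
  rewrite frac_inv_edivn // interrobang_small //; last first.
    by rewrite frac_itv // ltnW.
  rewrite IH //; [|by rewrite ltnW|by lia].
  by rewrite -exprnN rmorphM fmorphV rmorphXn rmorphB rmorph1 rmorphM !rmorph_nat.
rewrite interrobang_large; last first.
  have /andP[_ ->] := @frac_itv R a b ab b0.
  by rewrite andbT ltW // ltNge frac_le_half // -ltnNge.
(* The recursive fractions have numerator plus denominator b and 2b - a, the latter below a + b
   because b < 2a. *)
rewrite !frac_inv_sub1 // !frac_sub1 // IH ?IH; try lia.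
by rewrite !rmorphB !rmorphM !fmorphV rmorph1 !rmorph_nat.
Qed.

Lemma rat_frac (q : rat) : 0 <= q <= 1 ->
  exists a b, [/\ (a <= b)%N, (0 < b)%N, (a + b)%N = qheight q & q = a%:R / b%:R].
Proof.
move=> /andP[q0 q1].
have E : q = `|numq q|%N%:R / `|denq q|%N%:R.
  rewrite !natr_absz ger0_norm ?numq_ge0 // ger0_norm ?denq_ge0 //.
  by rewrite divq_num_den.
have d0 : (0 < `|denq q|)%N by rewrite absz_gt0 denq_neq0.
exists `|numq q|%N, `|denq q|%N; split => //.
by move: q1; rewrite {1}E ler_pdivrMr ?ltr0n // mul1r ler_nat.
Qed.

Lemma interrobang_ratr {R : realType} (q : rat) : 0 <= q <= 1 ->
  interrobang (ratr q : R) = ratr (interrobangQ q).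
Proof.
move=> /rat_frac[a [b [ab b0 E Eq]]]; rewrite /interrobangQ.
by rewrite [in LHS]Eq [in X in Iq_fuel _ X]Eq ratr_frac (interrobang_Iq_fuel (qheight q)) // E.
Qed.

(** * Strict monotonicity *)

(** For n > 1 the formula is strictly decreasing in the value at the parameter. For n = 1 the term
    with factor -3/4 gives strictness and the term in 1 - x varies in the same direction. *)
Lemma interrobang_piece_lt {R : realType} (n : nat) (s t : R) : (0 < n)%N ->
  0 <= s -> s < t -> t <= 1 -> interrobang s < interrobang t ->
  interrobang (n%:R + t)^-1 < interrobang (n%:R + s)^-1.
Proof.
move=> n0 s0 st t1 h; have t0 : 0 <= t by lra.
have [n1|n1|n1] := ltngtP n 1%N; first by lia.
  rewrite !interrobang_small //; try by apply/andP; split; lra.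
  by have := @expV4_gt0 R n; nra.
have lt := ltf_inv_natD n s t n0 s0 st.
have /andP[_ l1] := inv_natD_itv n s n0 s0.
have lh : 1 / 2 <= (n%:R + t)^-1 by rewrite n1 div1r lef_pV2 ?posrE; lra.
rewrite [X in X < _]interrobang_large; last by apply/andP; split; lra.
rewrite [X in _ < X]interrobang_large; last by apply/andP; split; lra.
have : interrobang (1 - (n%:R + s)^-1) <= interrobang (1 - (n%:R + t)^-1).
  by apply: interrobang_le; lra.
by rewrite !invrK n1 mulr1n ![1 + _ - 1]addrAC subrr !add0r; lra.
Qed.

Lemma interrobang_lt_right {R : realType} (n : nat) (t : R) : (0 < n)%N ->
  0 < t -> t <= 1 -> (forall z, 0 <= z -> z < t -> interrobang z < interrobang t) ->
  forall y, (n%:R + t)^-1 < y -> y <= 1 ->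
    interrobang (n%:R + t)^-1 < interrobang y.
Proof.
move=> n0 t0 t1 H y ty y1.
have p := natD_gt0 n t n0 (ltW t0).
have y0 : 0 < y by apply: lt_trans ty; rewrite invr_gt0.
have yt : y^-1 < n%:R + t by rewrite -[_ + _]invrK ltf_pV2 ?posrE ?invr_gt0.
(* Clipping at 0 replaces a y beyond the piece by its right endpoint 1/n, where the value is no
   larger than at y. *)
pose z := Num.max 0 (y^-1 - n%:R).
have z0 : 0 <= z by rewrite le_max lexx.
have zt : z < t by rewrite gt_max t0; lra.
have zy : y^-1 - n%:R <= z by rewrite le_max lexx orbT.
apply: lt_le_trans (interrobang_piece_lt n z t n0 z0 zt t1 (H z z0 zt)) _.
have pz := natD_gt0 n z n0 z0.
apply: interrobang_le => //; first by rewrite invr_ge0 ltW.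
by rewrite -[y]invrK lef_pV2 ?posrE ?invr_gt0 //; lra.
Qed.

Lemma interrobang_lt_left {R : realType} (n : nat) (t : R) : (0 < n)%N ->
  0 <= t -> t < 1 -> (forall z, t < z -> z <= 1 -> interrobang t < interrobang z) ->
  forall y, 0 <= y -> y < (n%:R + t)^-1 ->
    interrobang y < interrobang (n%:R + t)^-1.
Proof.
move=> n0 t0 t1 H y y0 yt.
have p := natD_gt0 n t n0 t0.
(* A y outside the piece is compared through the left endpoint 1/(n + 1). *)
have [yn|yn] := leP y (n%:R + 1)^-1.
  apply: le_lt_trans (interrobang_piece_lt n t 1 n0 t0 t1 (lexx 1) (H 1 t1 (lexx 1))).
  by apply: interrobang_le => //; have /andP[] := inv_natD_itv n 1 n0 (@ler01 R).
have p1 := natD_gt0 n 1 n0 (@ler01 R).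
have yp : 0 < y by apply: lt_trans yn; rewrite invr_gt0.
have yt' : n%:R + t < y^-1 by rewrite -[_ + t]invrK ltf_pV2 ?posrE ?invr_gt0.
have yn' : y^-1 < n%:R + 1 by rewrite -[_ + 1]invrK ltf_pV2 ?posrE ?invr_gt0.
have := interrobang_piece_lt n t (y^-1 - n%:R) n0 t0.
rewrite [n%:R + (_ - _)]addrC subrK invrK; apply; try lra.
by apply: H; lra.
Qed.

Lemma interrobang_gt0 {R : realType} (x : R) : 0 < x -> x <= 1 -> 0 < interrobang x.
Proof.
move=> x0 x1; have [|n [t [n0 /andP[t0 t1] ->]]] := inv_natD_exists x.
  by rewrite x0.
have n1 := natD_gt0 n 1 n0 (@ler01 R); have nt := natD_gt0 n t n0 t0.
have : interrobang (n%:R + 1)^-1 <= interrobang (n%:R + t)^-1.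
  apply: interrobang_le; first by rewrite invr_ge0 ltW.
    by rewrite lef_pV2 ?posrE // lerD2l ltW.
  by have /andP[] := inv_natD_itv n t n0 t0.
apply: lt_le_trans; rewrite natr1 -[_.+1%:R]addr0 interrobang_small //.
  by rewrite interrobang0 mulr0 subr0 mulr1 expV4_gt0.
by rewrite lexx ler01.
Qed.

(** The parameter r/a of a/b, with r = b %% a, satisfies r + a < a + b, so induction applies;
    strictness on one side of it gives strictness on the other side of a/b. *)
Lemma interrobang_frac_lt {R : realType} (m a b : nat) :
  (a <= b)%N -> (0 < b)%N -> (a + b <= m)%N ->
  (forall y : R, a%:R / b%:R < y -> y <= 1 ->
    interrobang (a%:R / b%:R) < interrobang y) /\
  (forall y : R, 0 <= y -> y < a%:R / b%:R ->
    interrobang y < interrobang (a%:R / b%:R)).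
Proof.
elim: m a b => [|m IH] a b ab b0 abm; first by lia.
have [->|an0] := eqVneq a 0%N.
  split=> y; rewrite mul0r; last by move=> y0 /(le_lt_trans y0); rewrite ltxx.
  by move=> *; rewrite interrobang0 interrobang_gt0.
have a0 : (0 < a)%N by rewrite lt0n.
have r0 := ltn_pmod b a0; have eb := divn_eq b a.
have n0 : (0 < b %/ a)%N by rewrite divn_gt0.
have /andP[t0 t1] := @modn_frac_itv R a b a0.
have [IHr IHl] := IH (b %% a)%N a (ltnW r0) a0 ltac:(lia).
split; last first.
  by rewrite frac_inv_edivn //; apply: interrobang_lt_left.
(* When r = 0 the parameter 0 has nothing on its left, so a/b = 1/q is rewritten as 1/((q - 1) + 1).
   The new parameter 1 = a/a is covered by induction, since 2a < a + b once q >= 2; for q = 1 the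
   point is 1. *)
have [r00|rn0] := eqVneq (b %% a)%N 0%N; last first.
  rewrite frac_inv_edivn //; apply: interrobang_lt_right => //; last exact: ltW.
  by rewrite divr_gt0 // ltr0n // lt0n.
have [n1|n1] := leqP (b %/ a) 1.
  have -> : a = b by nia.
  move=> y; rewrite divff ?pnatr_eq0 -?lt0n // => y1 y1'.
  by move: (lt_le_trans y1 y1'); rewrite ltxx.
have aE : a%:R / a%:R = 1 :> R by rewrite divff ?pnatr_eq0.
have [_ IH1] := IH a a (leqnn a) a0 ltac:(nia).
rewrite frac_inv_edivn // r00 mul0r addr0.
have -> : (b %/ a)%:R = (b %/ a).-1%:R + 1 :> R by rewrite natr1 prednK.
apply: interrobang_lt_right => //; first by lia.
by rewrite -aE.
Qed.

Lemma interrobang_lt {R : realType} (x y : R) :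
  0 <= x -> x < y -> y <= 1 -> interrobang x < interrobang y.
Proof.
move=> x0 xy y1; have [q] := rat_in_itvoo xy.
rewrite in_itv /= => /andP[xq qy].
have q01 : 0 <= q <= 1.
  rewrite -(ler0q R) -(ler_rat R q) rmorph1 (le_trans x0 (ltW xq)).
  exact: le_trans (ltW qy) y1.
have [a [b [ab b0 E Eq]]] := rat_frac q q01.
move: xq qy; rewrite Eq ratr_frac => xq qy.
have [hr hl] := @interrobang_frac_lt R _ a b ab b0 (leqnn _).
exact: lt_trans (hl x x0 xq) (hr y qy y1).
Qed.

(** * Uniqueness and conclusion *)

Lemma interrobang_unique {R : realType} (G : R -> R) :
  (forall x y : R, 0 <= x -> x < y -> y <= 1 -> G x < G y) ->
  (forall q : rat, 0 <= q <= 1 -> G (ratr q) = ratr (interrobangQ q)) ->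
  forall x : R, 0 <= x <= 1 -> G x = interrobang x.
Proof.
move=> Glt Gq x x01; have /andP[x0 x1] := x01.
have Gr q : 0 <= ratr q :> R -> ratr q <= 1 :> R -> G (ratr q) = interrobang (ratr q).
  rewrite ler0q -[1](rmorph1 (@ratr R)) ler_rat => q0 q1.
  by rewrite Gq ?interrobang_ratr ?q0.
(* A rational q between x and a right gap witness y gives G x < G q = F q < F y <= F x + e, and
   symmetrically on the left. The endpoints 0 and 1 are themselves rational. *)
apply/eqP; rewrite eq_le; apply/andP; split; apply/ler_addgt0Pr => e e0.
  have [rg _] := interrobang_gaps x e e0 x01.
  have [xlt|xge] := ltP x 1; last first.
    have -> : x = ratr 1 by rewrite rmorph1; lra.
    by rewrite Gr ?rmorph1 ?ler01 // lerDl ltW.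
  have [y [xy y1 h]] := rg xlt; have [q] := rat_in_itvoo xy.
  rewrite in_itv /= => /andP[xq qy].
  have := Glt x (ratr q) x0 xq ltac:(lra); rewrite Gr; try lra.
  by have := interrobang_lt (ratr q) y ltac:(lra) qy y1; lra.
have [_ lg] := interrobang_gaps x e e0 x01.
have [xlt|xge] := ltP 0 x; last first.
  have -> : x = ratr 0 by rewrite rmorph0; lra.
  by rewrite Gr ?rmorph0 ?ler01 // lerDl ltW.
have [y [y0 yx h]] := lg xlt; have [q] := rat_in_itvoo yx.
rewrite in_itv /= => /andP[yq qx].
have := Glt (ratr q) x ltac:(lra) qx x1; rewrite Gr; try lra.
by have := interrobang_lt y (ratr q) y0 yq ltac:(lra); lra.
Qed.

Theorem mainTheorem13 (R : realType) :
  exists F : R -> R,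
    [/\ {within `[0, 1], continuous F},
        (forall x y : R, 0 <= x -> x < y -> y <= 1 -> F x < F y),
        (forall q : rat, 0 <= q <= 1 -> F (ratr q) = ratr (interrobangQ q)),
        (forall G : R -> R,
           {within `[0, 1], continuous G} ->
           (forall x y : R, 0 <= x -> x < y -> y <= 1 -> G x < G y) ->
           (forall q : rat, 0 <= q <= 1 -> G (ratr q) = ratr (interrobangQ q)) ->
           forall x : R, 0 <= x <= 1 -> G x = F x)
      & [/\ F 0 = 0,
            (forall x : R, 0 < x <= 1 / 2 ->
               F x = (4 : R) ^ (- Num.floor x^-1) * (1 - 2 * F (fracpart x^-1))) &
            (forall x : R, 1 / 2 < x <= 1 ->
               F x = 3 / 8 - 3 / 4 * F (x^-1 - 1) - 1 / 2 * F (1 - x))]].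
Proof.
exists interrobang; split.
- exact: interrobang_continuous.
- exact: interrobang_lt.
- exact: interrobang_ratr.
- by move=> G _; exact: interrobang_unique.
- split; first exact: interrobang0.
  + move=> x /andP[x0 xh]; rewrite -interrobang_fixpoint.
      by rewrite {1}/interrobang_step leNgt x0 xh.
    by apply/andP; split; lra.
  + by move=> x /andP[xh x1]; apply: interrobang_large; rewrite ltW.
Qed.
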